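(* Let $p$ be a prime and let $R$ be a finite ring such that $p$ is the smallest prime dividing $|R|$. Then \[ \frac{|Z(R)|}{|R|}+\frac{p(|R|-|Z(R)|)}{|R|^2}\le \Pr(R)\le \frac{(p-1)|Z(R)|+|R|}{p|R|}. \]
   Context: Rings are associative and are not required to have an identity. For a finite ring $R$, $Z(R)=\{s\in R: sr=rs \text{ for all } r\in R\}$ is its center and $\Pr(R)=\dfrac{|\{(s,r)\in R\times R: sr=rs\}|}{|R|^2}$. *)

(* Defs.v *)
From HB Require Import structures.
From mathcomp Require Import all_boot all_order all_algebra.

Set Implicit Arguments.
Unset Strict Implicit.
Unset Printing Implicit Defensive.

Import GRing.Theory.
Local Open Scope ring_scope.

(* MathComp's pzRingType and nzRingType have a built-in identity; a rngType is
   an associative, possibly noncommutative ring with no identity required. *)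
HB.mixin Record Zmodule_isRng R of GRing.Zmodule R := {
  rmul : R -> R -> R;
  rmulA : associative rmul;
  rmulDl : left_distributive rmul +%R;
  rmulDr : right_distributive rmul +%R
}.

#[short(type="rngType")]
HB.structure Definition Rng := {R of Zmodule_isRng R & GRing.Zmodule R}.

#[short(type="finRngType")]
HB.structure Definition FinRng := {R of Rng R & Finite R}.

Declare Scope rng_scope.
Delimit Scope rng_scope with rng.
Notation "x * y" := (rmul x y) : rng_scope.

Definition rng_center (R : finRngType) : {set R} :=
  [set s : R | [forall r : R, (s * r == r * s)%rng]].

Definition commuting_prob (R : finRngType) : rat :=
  #|[set u : R * R | (u.1 * u.2 == u.2 * u.1)%rng]|%:R / #|R|%:R ^+ 2.

(* Main.v *)
From HB Require Import structures.
Require Import Defs.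
From mathcomp Require Import all_boot all_order all_algebra.
From mathcomp Require Import all_fingroup.
From mathcomp Require Import ring.

Import Order.TTheory GRing.Theory Num.Theory.

Local Open Scope ring_scope.

(** Counting commuting pairs by their second entry gives the sum over [r] of
    the sizes of the centralizers of [r].  A central [r] contributes [#|R|].
    The centralizer of a non-central [r] is a subgroup of the additive group of
    [R] which is proper, since [r] is not central, and nontrivial, since it
    contains [r], which is nonzero.  By Lagrange its order and its index are
    divisors of [#|R|] greater than 1, hence at least [p], so [r] contributes
    between [p] ([leq_card_rng_centralizer]) and [#|R| / p]
    ([leq_mul_card_rng_centralizer]).  Summing over the [#|R| - #|Z(R)|] non-central
    elements and dividing by [#|R| ^ 2] yields both bounds. *)

Lemma leq_min_prime_dvd (p n d : nat) :
  (forall q : nat, prime q -> (q %| n)%N -> (p <= q)%N) ->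
  (d %| n)%N -> (1 < d)%N -> (p <= d)%N.
Proof.
move=> p_min dvd_dn d_gt1; apply: leq_trans (pdiv_leq (ltnW d_gt1)).
by apply: p_min; rewrite ?pdiv_prime // (dvdn_trans (pdiv_dvd d)).
Qed.

(** The group structure is the additive one, so that Lagrange's theorem for
    finite groups speaks of additive subgroups of [R]. *)
HB.instance Definition _ (R : finRngType) := [finGroupMixin of R for +%R].

Section Centralizer.

Variable R : finRngType.
Implicit Types r s : R.

Lemma rmul0r r : rmul 0 r = 0.
Proof. by apply: (addrI (rmul 0 r)); rewrite -rmulDl !addr0. Qed.

Lemma rmulr0 r : rmul r 0 = 0.
Proof. by apply: (addrI (rmul r 0)); rewrite -rmulDr !addr0. Qed.

Definition rng_centralizer r : {set R} := [set s | rmul s r == rmul r s].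

(** Closure under opposites is automatic, because the group is finite. *)
Lemma rng_centralizer_group_set r : group_set (rng_centralizer r).
Proof.
apply/group_setP; split=> [|s t]; first by rewrite inE rmul0r rmulr0.
by rewrite !inE => /eqP Cs /eqP Ct; rewrite rmulDl rmulDr Cs Ct.
Qed.

Canonical rng_centralizer_group r := Group (rng_centralizer_group_set r).

Lemma card_rng_centralizer_dvd r : (#|rng_centralizer r| %| #|R|)%N.
Proof. by rewrite -cardsT cardSg ?subsetT. Qed.

Lemma rng_centralizer_central r :
  r \in rng_center R -> rng_centralizer r = setT.
Proof.
rewrite inE => /forallP Zr; apply/setP=> s.
by rewrite !inE eq_sym Zr.
Qed.

Lemma rng_centralizer_noncentral_proper r :
  r \notin rng_center R -> (#|rng_centralizer r| < #|R|)%N.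
Proof.
rewrite inE => /forallPn[s rs]; rewrite -cardsT; apply/proper_card/properP.
by split; [exact: subsetT | exists s; rewrite // inE eq_sym].
Qed.

Lemma rng_centralizer_noncentral_nontrivial r :
  r \notin rng_center R -> (1 < #|rng_centralizer r|)%N.
Proof.
move=> Zr; apply/card_gt1P; exists 0, r; split.
- by rewrite inE rmul0r rmulr0.
- by rewrite inE.
apply: contra Zr => /eqP <-; rewrite inE; apply/forallP=> s.
by rewrite rmul0r rmulr0.
Qed.

Lemma card_commuting_pairs :
  #|[set u : R * R | rmul u.1 u.2 == rmul u.2 u.1]|
    = (\sum_(r : R) #|rng_centralizer r|)%N.
Proof.
under eq_bigr do rewrite -sum1_card.
rewrite -sum1_card pair_big_dep /= (reindex (fun u : R * R => (u.2, u.1))) /=.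
  by apply: eq_bigl => -[s r]; rewrite !inE /= eq_sym.
by exists (fun u : R * R => (u.2, u.1)) => -[].
Qed.

Lemma card_noncentral : (#|~: rng_center R| + #|rng_center R|)%N = #|R|.
Proof. by rewrite addnC cardsC. Qed.

Lemma card_commuting_pairs_center_split :
  #|[set u : R * R | rmul u.1 u.2 == rmul u.2 u.1]|
    = (#|rng_center R| * #|R|
       + \sum_(r in ~: rng_center R) #|rng_centralizer r|)%N.
Proof.
rewrite card_commuting_pairs (bigID (mem (rng_center R))) /=; congr (_ + _)%N.
  rewrite -sum_nat_const; apply: eq_bigr => r Zr.
  by rewrite rng_centralizer_central // cardsT.
by apply: eq_bigl => r; rewrite [in RHS]inE.
Qed.

Section SmallestPrimeDivisor.

Variable p : nat.
Hypothesis p_min : forall q : nat, prime q -> (q %| #|R|)%N -> (p <= q)%N.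

(** The order of the centralizer is a divisor of [#|R|], greater than 1 because
    [0] and [r] are two elements of it. *)
Lemma leq_card_rng_centralizer r :
  r \notin rng_center R -> (p <= #|rng_centralizer r|)%N.
Proof.
move=> Zr; apply: (leq_min_prime_dvd _ _ _ p_min).
  exact: card_rng_centralizer_dvd.
exact: rng_centralizer_noncentral_nontrivial.
Qed.

(** The index of the centralizer is a divisor of [#|R|], greater than 1 because
    the centralizer is proper. *)
Lemma leq_mul_card_rng_centralizer r :
  r \notin rng_center R -> (p * #|rng_centralizer r| <= #|R|)%N.
Proof.
move=> Zr; have /dvdnP[k Dk] := card_rng_centralizer_dvd r.
have C_lt := rng_centralizer_noncentral_proper r Zr.
rewrite Dk leq_mul //; apply: (leq_min_prime_dvd _ _ _ p_min).
  by rewrite Dk dvdn_mulr.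
by move: C_lt; rewrite Dk; case: k {Dk} => [|[|k]]; rewrite ?mul0n ?mul1n ?ltnn.
Qed.

Lemma leq_card_commuting_pairs :
  (#|rng_center R| * #|R| + p * #|~: rng_center R|
   <= #|[set u : R * R | rmul u.1 u.2 == rmul u.2 u.1]|)%N.
Proof.
rewrite card_commuting_pairs_center_split leq_add2l mulnC -sum_nat_const.
by apply: leq_sum => r; rewrite inE; apply: leq_card_rng_centralizer.
Qed.

Lemma card_commuting_pairs_leq :
  (p * #|[set u : R * R | rmul u.1 u.2 == rmul u.2 u.1]|
   <= p * (#|rng_center R| * #|R|) + #|~: rng_center R| * #|R|)%N.
Proof.
rewrite card_commuting_pairs_center_split mulnDr leq_add2l.
rewrite big_distrr -sum_nat_const.
by apply: leq_sum => r; rewrite inE; apply: leq_mul_card_rng_centralizer.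
Qed.

End SmallestPrimeDivisor.

End Centralizer.

Theorem corollary2p6 (p : nat) (R : finRngType)
  (p_prime : prime p) (p_dvd : (p %| #|R|)%N)
  (p_min : forall q : nat, prime q -> (q %| #|R|)%N -> (p <= q)%N) :
  #|rng_center R|%:R / #|R|%:R
    + p%:R * (#|R|%:R - #|rng_center R|%:R) / #|R|%:R ^+ 2
    <= commuting_prob R
  /\
  commuting_prob R
    <= ((p%:R - 1) * #|rng_center R|%:R + #|R|%:R) / (p%:R * #|R|%:R).
Proof.
have lower := leq_card_commuting_pairs R p p_min.
have upper := card_commuting_pairs_leq R p p_min.
rewrite /commuting_prob; move: lower upper.
set N := #|[set u : R * R | _]|; set z := #|rng_center R|.
have n_gt0 : 0 < #|R|%:R :> rat by rewrite ltr0n; apply/card_gt0P; exists 0.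
have p_gt0 : 0 < p%:R :> rat by rewrite ltr0n prime_gt0.
have n_neq0 := lt0r_neq0 n_gt0; have p_neq0 := lt0r_neq0 p_gt0.
have Dm : #|~: rng_center R|%:R = #|R|%:R - z%:R :> rat.
  by rewrite -(card_noncentral R) natrD addrK.
rewrite -!(ler_nat rat) !(natrD, natrM) Dm => lower upper; split.
  rewrite ler_pdivlMr ?exprn_gt0 //; apply: le_trans lower.
  by rewrite le_eqVlt; apply/orP; left; apply/eqP; field.
rewrite ler_pdivrMr ?exprn_gt0 // -(ler_pM2l p_gt0); apply: le_trans upper _.
by rewrite le_eqVlt; apply/orP; left; apply/eqP; field; rewrite n_neq0 p_neq0.
Qed.
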